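(* Let $1<b<2$ and let $C_\omega\in\mathbb R$, $C_\omega\neq0$. Suppose that the velocity field of the form $$v_R=\frac{G(x)}{r^b},\qquad v_\alpha=\frac{F(x)}{r^b},\qquad v_\theta=\frac{\Omega(x)}{r^b},\qquad x=\cos\alpha,\quad r=R\sin\alpha,$$ together with some scalar pressure $p$, is a classical solution of the steady incompressible Euler equations $$(\mathbf v\cdot\nabla)\mathbf v=-\nabla p,\qquad \nabla\cdot\mathbf v=0$$ in $\{R>0,\ 0<\alpha<\pi/2\}$, subject to the conditions $$F(0)=0,\qquad \lim_{x\to1^-}F(x)(1-x^2)^{(1-b)/2}=0,\qquad \lim_{x\to1^-}\Omega(x)=C_\omega .$$ Then the solution violates Rayleigh's circulation criterion (and so is unstable with respect to axisymmetric perturbations in the sense of that criterion): the Rayleigh discriminant $$\Phi=\frac{1}{r^3}\,\frac{\partial}{\partial r}\bigl(r v_\theta\bigr)^2,$$ with $v_\theta$ expressed in cylindrical coordinates $(r,z)$ and $\partial/\partial r$ taken at fixed $z$, is not nonnegative throughout $\{r>0,\ z>0\}$, i.e. $\Phi<0$ at some point.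
   Context: Spherical coordinates $(R,\alpha,\theta)$ on $\mathbb R^3$: $R$ is the distance to the origin, $\alpha$ is the angle between the radius vector and the positive $z$-axis, and $\theta$ is the meridian angle about the $z$-axis; $\alpha=0$ is the vortex axis and $\alpha=\pi/2$ is the ground plane. The components $v_R,v_\alpha,v_\theta$ of $\mathbf v$ are taken with respect to the orthonormal spherical frame $(\mathbf e_R,\mathbf e_\alpha,\mathbf e_\theta)$. In cylindrical coordinates $r=R\sin\alpha$, $z=R\cos\alpha$, so $x=\cos\alpha=z/\sqrt{r^2+z^2}$. The scaled pressure $p=p(R,\alpha,\theta)$ is a single-valued $C^1$ function, hence $2\pi$-periodic in $\theta$. ''Classical'' means that all derivatives of $F,G,\Omega$ occurring in the equations after elimination of the pressure exist and are continuous on the open interval $(0,1)$ ($F\in C^3(0,1)$, $G\in C^2(0,1)$, $\Omega\in C^1(0,1)$), and the equations hold pointwise. $F$ extends continuously to $x=0$ (with value $F(0)=0$, expressing that there is no source or sink at the ground); slip at the ground is allowed, so no condition is imposed on $G$ and $\Omega$ at $x=0$. Rayleigh's circulation criterion for stability with respect to axisymmetric perturbations is the requirement that $\Phi\ge0$ everywhere; a flow is called unstable (in the sense of this criterion) if the requirement fails. *)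

(* Defs.v *)
From Stdlib Require Import Reals.
From Coquelicot Require Import Coquelicot.
Open Scope R_scope.

(* Scalar fields are functions of the spherical coordinates (rho, a, th):
   distance to the origin, angle from the positive z-axis, meridian angle. *)

Definition flow_region (rho a th : R) : Prop := 0 < rho /\ 0 < a < PI / 2.

Definition d_rho (f : R -> R -> R -> R) (rho a th : R) : R :=
  Derive (fun t => f t a th) rho.
Definition d_a (f : R -> R -> R -> R) (rho a th : R) : R :=
  Derive (fun t => f rho t th) a.
Definition d_th (f : R -> R -> R -> R) (rho a th : R) : R :=
  Derive (fun t => f rho a t) th.

(* [Derive] is total, so differentiability is required separately; continuity
   of the partial derivatives is joint continuity on R * R * R. *)
Definition C1_flow_region (f : R -> R -> R -> R) : Prop :=
  forall rho a th, flow_region rho a th ->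
    ex_derive (fun t => f t a th) rho /\
    ex_derive (fun t => f rho t th) a /\
    ex_derive (fun t => f rho a t) th /\
    continuous (fun q : R * R * R => d_rho f (fst (fst q)) (snd (fst q)) (snd q))
               (rho, a, th) /\
    continuous (fun q : R * R * R => d_a f (fst (fst q)) (snd (fst q)) (snd q))
               (rho, a, th) /\
    continuous (fun q : R * R * R => d_th f (fst (fst q)) (snd (fst q)) (snd q))
               (rho, a, th).

Definition single_valued (f : R -> R -> R -> R) : Prop :=
  forall rho a th, flow_region rho a th -> f rho a (th + 2 * PI) = f rho a th.

Definition advect (vR va vth f : R -> R -> R -> R) (rho a th : R) : R :=
  vR rho a th * d_rho f rho a th
  + va rho a th / rho * d_a f rho a th
  + vth rho a th / (rho * sin a) * d_th f rho a th.

(* Components of (v . grad) v in the orthonormal spherical frame; the quadratic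
   terms come from the rotation of the frame. *)
Definition convection_R (vR va vth : R -> R -> R -> R) (rho a th : R) : R :=
  advect vR va vth vR rho a th
  - ((va rho a th) ^ 2 + (vth rho a th) ^ 2) / rho.
Definition convection_a (vR va vth : R -> R -> R -> R) (rho a th : R) : R :=
  advect vR va vth va rho a th
  + vR rho a th * va rho a th / rho
  - (vth rho a th) ^ 2 * (cos a / sin a) / rho.
Definition convection_th (vR va vth : R -> R -> R -> R) (rho a th : R) : R :=
  advect vR va vth vth rho a th
  + vR rho a th * vth rho a th / rho
  + va rho a th * vth rho a th * (cos a / sin a) / rho.

Definition divergence (vR va vth : R -> R -> R -> R) (rho a th : R) : R :=
  / rho ^ 2 * d_rho (fun s c t => s ^ 2 * vR s c t) rho a th
  + / (rho * sin a) * d_a (fun s c t => sin c * va s c t) rho a th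
  + / (rho * sin a) * d_th vth rho a th.

Definition steady_euler (vR va vth p : R -> R -> R -> R) : Prop :=
  forall rho a th, flow_region rho a th ->
    convection_R vR va vth rho a th = - d_rho p rho a th /\
    convection_a vR va vth rho a th = - (/ rho * d_a p rho a th) /\
    convection_th vR va vth rho a th = - (/ (rho * sin a) * d_th p rho a th) /\
    divergence vR va vth rho a th = 0.

(* The field f(x) / r^b with x = cos a and r = rho * sin a. *)
Definition profile_field (b : R) (f : R -> R) (rho a th : R) : R :=
  f (cos a) / Rpower (rho * sin a) b.

Definition Cn_unit (n : nat) (f : R -> R) : Prop :=
  forall x, 0 < x < 1 ->
    (forall k, (k <= n)%nat -> ex_derive_n f k x) /\
    continuous (Derive_n f n) x.

Definition in_cylindrical (f : R -> R -> R -> R) (r th z : R) : R :=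
  f (sqrt (r ^ 2 + z ^ 2)) (acos (z / sqrt (r ^ 2 + z ^ 2))) th.

Definition rayleigh_discriminant (vth : R -> R -> R -> R) (r th z : R) : R :=
  / r ^ 3 * Derive (fun s => (s * in_cylindrical vth s th z) ^ 2) r.

(* Main.v *)
Require Import Defs.
From Stdlib Require Import Reals Lra.
From Coquelicot Require Import Coquelicot.
Open Scope R_scope.

(** At fixed [z] the squared circulation is [Omega x ^ 2 * r ^ (2 - 2b)]. As
    [r -> 0] one has [x -> 1], so [Omega x] tends to [Comega <> 0], while
    [r ^ (2 - 2b)] blows up because [b > 1]. A function that tends to [+oo] at
    [0+] cannot be nondecreasing, so by the mean value theorem its derivative is
    negative somewhere. *)

Lemma Derive_neg_of_at_right_p_infty (f : R -> R) :
  (forall s, 0 < s -> ex_derive f s) ->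
  filterlim f (at_right 0) (Rbar_locally p_infty) ->
  exists s, 0 < s /\ Derive f s < 0.
Proof.
intros df lim_f.
assert (ev1 : at_right 0 (fun s => f 1 < f s)).
{ apply lim_f. now exists (f 1). }
assert (ev2 : at_right 0 (fun s => 0 < s < 1)).
{ exists (mkposreal 1 Rlt_0_1). intros s Hs s_gt0.
  apply Rabs_def2 in Hs. simpl in Hs. unfold minus, plus, opp in Hs.
  simpl in Hs. lra. }
destruct (filter_ex _ (filter_and _ _ ev1 ev2)) as [s [f_lt s_int]].
(* Since [f 1 < f s] with [s < 1], the chord over [[s, 1]] has negative slope, and this slope is
   [Derive f c]. *)
destruct (MVT_gen f s 1 (Derive f)) as [c [c_int Hc]];
  rewrite ?Rmin_left, ?Rmax_right in * by lra.
{ intros c Hc. apply Derive_correct, df. lra. }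
{ intros c Hc. apply continuity_pt_filterlim, (ex_derive_continuous f), df. lra. }
exists c. split; nra.
Qed.

(** Keeps the polar cosine strictly below 1 off the axis on the slice [z = 1]; the unsimplified
    [1 ^ 2] matches [z ^ 2] at that height. *)
Lemma sqrt_sqr_add1_gt1 (s : R) : 0 < s -> 1 < sqrt (s ^ 2 + 1 ^ 2).
Proof. intros Hs. rewrite <- sqrt_1 at 1. apply sqrt_lt_1; nra. Qed.

(** With [rho] the distance to the origin, [sin (acos (z / rho)) = r / rho], so the denominator
    [rho * sin a] collapses to [r]. *)
Lemma in_cylindrical_profile_field (b : R) (f : R -> R) (r th z : R) :
  0 < r ->
  in_cylindrical (profile_field b f) r th z
  = f (z / sqrt (r ^ 2 + z ^ 2)) / Rpower r b.
Proof.
intros Hr. unfold in_cylindrical, profile_field.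
set (rho := sqrt (r ^ 2 + z ^ 2)).
assert (rho_gt0 : 0 < rho) by (apply sqrt_lt_R0; nra).
assert (rho2 : rho ^ 2 = r ^ 2 + z ^ 2) by (apply pow2_sqrt; nra).
assert (x_int : -1 <= z / rho <= 1).
{ split; [apply Rle_div_r | apply Rle_div_l]; nra. }
rewrite cos_acos, sin_acos by exact x_int.
replace (1 - Rsqr (z / rho)) with (Rsqr (r / rho)).
- rewrite sqrt_Rsqr.
  + now replace (rho * (r / rho)) with r by (field; lra).
  + apply Rlt_le, Rdiv_lt_0_compat; lra.
- apply (Rmult_eq_reg_r (rho ^ 2)); [|nra].
  unfold Rsqr. field_simplify; lra.
Qed.

Lemma circulation_sq_profile_field (b : R) (f : R -> R) (r th z : R) :
  0 < r ->
  (r * in_cylindrical (profile_field b f) r th z) ^ 2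
  = f (z / sqrt (r ^ 2 + z ^ 2)) ^ 2 * exp (2 * (1 - b) * ln r).
Proof.
intros Hr. rewrite in_cylindrical_profile_field by exact Hr.
(* Each copy of [ln r - b * ln r] exponentiates to one factor [r / Rpower r b] of the square. *)
replace (2 * (1 - b) * ln r) with ((ln r - b * ln r) + (ln r - b * ln r))
  by ring.
unfold Rpower, Rminus.
rewrite !exp_plus, exp_Ropp, exp_ln by exact Hr.
field. apply Rgt_not_eq, exp_pos.
Qed.

(** Continuity at [s = 0] gives the limit 1; the approach is from below because the square root
    exceeds 1 for [s > 0]. This one-sidedness is what allows composition with a limit of [f] at
    [at_left 1]. *)
Lemma cylindrical_cos_at_axis :
  filterlim (fun s => 1 / sqrt (s ^ 2 + 1 ^ 2)) (at_right 0) (at_left 1).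
Proof.
intros P HP.
assert (cont : continuous (fun s => 1 / sqrt (s ^ 2 + 1 ^ 2)) 0).
{ apply (ex_derive_continuous (fun s => 1 / sqrt (s ^ 2 + 1 ^ 2))).
  auto_derive. repeat split; trivial; [lra|].
  apply Rgt_not_eq, sqrt_lt_R0. lra. }
unfold continuous in cont.
replace (1 / sqrt (0 ^ 2 + 1 ^ 2)) with 1 in cont
  by (replace (0 ^ 2 + 1 ^ 2) with 1 by ring; rewrite sqrt_1; field).
specialize (cont _ HP). unfold filtermap in *. simpl in cont.
refine (filter_imp _ _ _ cont). intros s Hs s_gt0. apply Hs.
assert (H := sqrt_sqr_add1_gt1 s s_gt0).
apply Rlt_div_l; simpl in H |- *; lra.
Qed.

Lemma circulation_sq_at_axis (b C : R) (f : R -> R) (th : R) :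
  1 < b -> C <> 0 ->
  filterlim f (at_left 1) (locally C) ->
  filterlim (fun s => (s * in_cylindrical (profile_field b f) s th 1) ^ 2)
    (at_right 0) (Rbar_locally p_infty).
Proof.
intros Hb HC lim_f.
assert (lim_sq : filterlim (fun s => f (1 / sqrt (s ^ 2 + 1 ^ 2)) ^ 2)
                   (at_right 0) (Rbar_locally (C ^ 2))).
{ apply (filterlim_comp _ _ _ (fun s => f (1 / sqrt (s ^ 2 + 1 ^ 2)))
           (fun y => y ^ 2) _ (locally C)).
  - exact (filterlim_comp _ _ _ _ _ _ _ _ cylindrical_cos_at_axis lim_f).
  - apply (ex_derive_continuous (fun y => y ^ 2)). now auto_derive. }
assert (lim_exp : filterlim (fun s => exp (2 * (1 - b) * ln s))
                    (at_right 0) (Rbar_locally p_infty)).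
{ apply (filterlim_comp _ _ _ (fun s => 2 * (1 - b) * ln s) exp _
           (Rbar_locally p_infty)); [|exact is_lim_exp_p].
  apply (filterlim_comp _ _ _ ln (fun y => 2 * (1 - b) * y) _
           (Rbar_locally m_infty)); [exact is_lim_ln_0|].
  (* As [b > 1], the factor [2 * (1 - b)] is negative and turns the limit [m_infty] of [ln] into
     [p_infty]. *)
  replace p_infty with (Rbar_mult (2 * (1 - b)) m_infty).
  - apply filterlim_Rbar_mult_l.
  - apply is_Rbar_mult_unique, is_Rbar_mult_sym.
    apply is_Rbar_mult_m_infty_neg. simpl. lra. }
apply (filterlim_ext_loc
         (fun s => f (1 / sqrt (s ^ 2 + 1 ^ 2)) ^ 2 * exp (2 * (1 - b) * ln s))).
{ exists (mkposreal 1 Rlt_0_1). intros s _ s_gt0. symmetry.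
  now apply circulation_sq_profile_field. }
eapply filterlim_comp_2; [exact lim_sq | exact lim_exp |].
(* The product of limits is determinate because [C <> 0] makes [C ^ 2] positive. *)
apply (filterlim_Rbar_mult (C ^ 2) p_infty p_infty).
apply is_Rbar_mult_sym, is_Rbar_mult_p_infty_pos. simpl.
destruct (Rdichotomy _ _ HC); nra.
Qed.

Lemma ex_derive_circulation_sq (b : R) (f : R -> R) (r th : R) :
  Cn_unit 1 f -> 0 < r ->
  ex_derive (fun s => (s * in_cylindrical (profile_field b f) s th 1) ^ 2) r.
Proof.
intros Hf Hr.
apply (ex_derive_ext_loc
         (fun s => f (1 / sqrt (s ^ 2 + 1 ^ 2)) ^ 2 * exp (2 * (1 - b) * ln s))).
(* The ball of radius [r] about [r] contains only positive [s], where the closed form holds. *)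
{ exists (mkposreal r Hr). intros s Hs. symmetry.
  apply circulation_sq_profile_field. apply Rabs_def2 in Hs.
  unfold minus, plus, opp in Hs. simpl in Hs. lra. }
assert (H := sqrt_sqr_add1_gt1 r Hr).
assert (x_int : 0 < 1 / sqrt (r ^ 2 + 1 ^ 2) < 1).
{ split; [apply Rdiv_lt_0_compat | apply Rlt_div_l]; lra. }
assert (df : ex_derive f (1 / sqrt (r ^ 2 + 1 ^ 2))).
{ exact (proj1 (Hf _ x_int) 1%nat (le_n 1)). }
simpl in df, H |- *.
auto_derive. repeat split; trivial; try nra.
Qed.

Theorem mainTheorem5 (b Comega : R) (F G Omega : R -> R)
    (p : R -> R -> R -> R)
    (hb : 1 < b < 2)
    (hC : Comega <> 0)
    (hF : Cn_unit 3 F) (hG : Cn_unit 2 G) (hOmega : Cn_unit 1 Omega)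
    (hp : C1_flow_region p) (hp_single : single_valued p)
    (h_euler : steady_euler (profile_field b G) (profile_field b F)
                 (profile_field b Omega) p)
    (hF_cont0 : filterlim F (at_right 0) (locally (F 0)))
    (hF0 : F 0 = 0)
    (hF1 : filterlim (fun x => F x * Rpower (1 - x ^ 2) ((1 - b) / 2))
             (at_left 1) (locally 0))
    (hOmega1 : filterlim Omega (at_left 1) (locally Comega)) :
  exists r th z : R,
    0 < r /\ 0 < z /\
    rayleigh_discriminant (profile_field b Omega) r th z < 0.
Proof.
destruct (Derive_neg_of_at_right_p_infty
            (fun s => (s * in_cylindrical (profile_field b Omega) s 0 1) ^ 2))
  as [r [Hr Hneg]].
- intros s Hs. now apply ex_derive_circulation_sq.
- exact (circulation_sq_at_axis b Comega Omega 0 (proj1 hb) hC hOmega1).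
(* The angle 0 is arbitrary, as the field does not depend on [th]; any positive height would serve
   as well as 1. The prefactor [/ r ^ 3] is positive and preserves the sign. *)
- exists r, 0, 1. repeat split; [exact Hr | lra |].
  unfold rayleigh_discriminant.
  assert (0 < / r ^ 3) by (apply Rinv_0_lt_compat, pow_lt; exact Hr).
  nra.
Qed.
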